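(* Let $X$ be a non-empty locally connected completely regular space such that no (connected) component of $X$ is compact. Let $\mathscr{P}$ be a closed hereditary finitely additive co-local topological property. If every component of $X$ has $\mathscr{P}$ (in particular, if $X$ has $\mathscr{P}$), then $X$ has a completely regular one-point connectification that has $\mathscr{P}$.
   Context: Completely regular means completely regular and Hausdorff (i.e. Tychonoff). A space $X$ is locally connected if for every $x\in X$, every neighborhood of $x$ in $X$ contains a connected neighborhood of $x$ in $X$. A space $Y$ is an extension of a space $X$ if $Y$ contains $X$ as a dense subspace; it is a one-point extension if moreover $Y\setminus X$ is a singleton. A one-point connectification of $X$ is a one-point extension of $X$ that is connected. A topological property is a property of topological spaces invariant under homeomorphism. Let $\mathscr{P}$ be a topological property. Then: (1) $\mathscr{P}$ is closed hereditary if any closed subspace of a space having $\mathscr{P}$ has $\mathscr{P}$. (2) $\mathscr{P}$ is finitely additive if any space which is expressible as a finite disjoint union of closed subspaces each having $\mathscr{P}$ has $\mathscr{P}$. (3) $\mathscr{P}$ is co-local if a space $X$ has $\mathscr{P}$ provided that it contains a point $p$ with an open base $\mathscr{B}$ for $X$ at $p$ such that $X\setminus B$ has $\mathscr{P}$ for every $B\in\mathscr{B}$. *)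

(* Defs.v *)
From HB Require Import structures.
From mathcomp Require Import all_boot all_order all_algebra.
From mathcomp Require Import all_classical all_reals all_analysis.

Set Implicit Arguments.
Unset Strict Implicit.
Unset Printing Implicit Defensive.

Local Open Scope classical_set_scope.

(* The library's [completely_regular_space] has no separation axiom built in.
   Its [uniform_separator] means separation by a continuous function into
   [0, 1] (lemma [uniform_separatorP]). *)
Definition tychonoff_space (X : topologicalType) : Prop :=
  completely_regular_space X /\ hausdorff_space X.

Definition locally_connected_space (X : topologicalType) : Prop :=
  forall (x : X) (U : set X), nbhs x U ->
    exists V : set X, [/\ nbhs x V, V `<=` U & connected V].

Definition component (X : topologicalType) (x : X) : set X :=
  connected_component [set: X] x.

Definition homeomorphic (X Y : topologicalType) : Prop :=
  exists (f : X -> Y) (g : Y -> X),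
    [/\ cancel f g, cancel g f, continuous f & continuous g].

(* "Y contains X as a subspace" is expressed by an injection X -> Y for which
   the topology of X is the one induced from Y. *)
Definition is_embedding (X Y : topologicalType) (e : X -> Y) : Prop :=
  injective e /\
  forall U : set X, open U <-> exists2 V : set Y, open V & e @^-1` V = U.

Definition is_extension (X Y : topologicalType) (e : X -> Y) : Prop :=
  is_embedding e /\ dense (range e).

Definition is_one_point_extension (X Y : topologicalType) (e : X -> Y) : Prop :=
  is_extension e /\ exists p : Y, ~` range e = [set p].

Definition is_one_point_connectification (X Y : topologicalType) (e : X -> Y)
    : Prop :=
  is_one_point_extension e /\ connected [set: Y].

(* Below, a set [A : set X] used where a topologicalType is expected is the
   subtype [set_type A] with the subspace topology (subtype_topology.v). *)

Definition topological_property (P : topologicalType -> Prop) : Prop :=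
  forall X Y : topologicalType, homeomorphic X Y -> P X -> P Y.

Definition closed_hereditary (P : topologicalType -> Prop) : Prop :=
  forall (X : topologicalType) (A : set X), closed A -> P X -> P (set_type A).

(* Unions of at least one piece.  Allowing the empty union would only add that
   the empty space has P, which any closed hereditary P satisfies as soon as
   some space has it. *)
Definition finitely_additive (P : topologicalType -> Prop) : Prop :=
  forall (X : topologicalType) (n : nat) (F : 'I_n.+1 -> set X),
    (forall i, closed (F i)) -> trivIset [set: 'I_n.+1] F ->
    \bigcup_i F i = [set: X] ->
    (forall i, P (set_type (F i))) -> P X.

Definition open_base_at (X : topologicalType) (p : X) (B : set (set X)) : Prop :=
  (forall U, B U -> open U /\ U p) /\
  (forall N, nbhs p N -> exists2 U, B U & U `<=` N).

Definition co_local (P : topologicalType -> Prop) : Prop :=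
  forall (X : topologicalType) (p : X) (B : set (set X)),
    open_base_at p B -> (forall U, B U -> P (set_type (~` U))) -> P X.

(* Main.v *)
(* In a locally connected space every component C is clopen.  Since C is not
   compact, it carries a proper filter G_C without cluster point in C.  Call a
   continuous f : X -> [0, +oo[ vanishing if f tends to 0 along every G_C and f
   is zero on all but finitely many components.  The sets [f < 1], f vanishing,
   form a filter, which we take as the trace of the neighborhoods of a new point
   p.  Vanishing functions extend continuously by 0 at p; there are enough of
   them to separate points from closed sets, since the G_C are free.  Every
   component has p in its closure, so X + p is connected.  The complement of an
   open neighborhood of p meets only finitely many components, each in a closed
   set, hence has P; co-locality at p then gives P for X + p. *)
Require Import Defs.
From HB Require Import structures.
From mathcomp Require Import all_boot all_order all_algebra.
From mathcomp Require Import all_classical all_reals all_analysis.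
From mathcomp Require Import Rstruct.

Set Implicit Arguments.
Unset Strict Implicit.
Unset Printing Implicit Defensive.

Local Open Scope classical_set_scope.

Import Order.TTheory GRing.Theory Num.Theory.
Import numFieldNormedType.Exports.

(* The proof of [Filter F] is a parameter so that the topology below can be
   declared as a canonical structure keyed on [add_point]. *)
Definition add_point (X : topologicalType) (F : set_system X)
  (FF : Filter F) : Type := option X.

(** * Adjoining one point whose punctured neighborhoods are prescribed by a filter *)

Section AddPoint.
Context {X : topologicalType} (F : set_system X) (FF : Filter F).

HB.instance Definition _ := Choice.on (add_point FF).

Definition add_point_incl (x : X) : add_point FF := Some x.
Local Notation incl := add_point_incl.

Definition add_point_open : set_system (add_point FF) :=
  [set V | open (incl @^-1` V) /\ (V None -> F (incl @^-1` V))].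

Let add_point_openT : add_point_open setT.
Proof. by split=> [|_]; [exact: openT|exact: filterT]. Qed.

Let add_point_openI : setI_closed add_point_open.
Proof.
move=> A B [oA FA] [oB FB]; split; first exact: openI.
by move=> [/FA ? /FB ?]; exact: filterI.
Qed.

Let add_point_open_bigU (I : Type) (f : I -> set (add_point FF)) :
  (forall i, add_point_open (f i)) -> add_point_open (\bigcup_i f i).
Proof.
move=> of_; split.
  by rewrite preimage_bigcup; apply: bigcup_open => i _; case: (of_ i).
move=> [i _ fi]; have [_ /(_ fi)] := of_ i.
by apply: filterS => x ?; exists i.
Qed.

HB.instance Definition _ := isOpenTopological.Build (add_point FF)
  add_point_openT add_point_openI add_point_open_bigU.

Lemma add_pointP (y : add_point FF) : y = None \/ exists x, y = incl x.
Proof. by case: y => [x|]; [right; exists x|left]. Qed.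

Lemma open_add_pointE (V : set (add_point FF)) :
  open V <-> open (incl @^-1` V) /\ (V None -> F (incl @^-1` V)).
Proof. by []. Qed.

Lemma add_point_incl_continuous : continuous incl.
Proof. by apply/continuousP => V /open_add_pointE[]. Qed.

Lemma add_point_continuous (Z : topologicalType) (g : add_point FF -> Z) :
  continuous (g \o incl) -> g \o incl @ F --> g None -> continuous g.
Proof.
move=> /continuousP gc gF; apply/continuousP => V oV.
apply/open_add_pointE; split; first exact: gc.
by move=> Vg; apply: gF; exact: open_nbhs_nbhs.
Qed.

Lemma add_point_embedding : is_embedding incl.
Proof.
split=> [x y [] //|U]; split=> [oU|[V /open_add_pointE[oV _] <-] //].
exists (incl @` U).
  apply/open_add_pointE; split; last by case.
  suff -> : incl @^-1` (incl @` U) = U by [].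
  by apply/seteqP; split => z; [case=> ? ? [<-]|exists z].
by apply/seteqP; split => z; [case=> ? ? [<-]|exists z].
Qed.

(** Properness is what gives density: the trace of an open set containing the new point belongs to
    [F], so it is non-empty. *)
Lemma add_point_one_point_extension :
  ProperFilter F -> is_one_point_extension incl.
Proof.
move=> PF; split; last first.
  exists None; apply/seteqP; split=> y.
    by have [//|[x ->]] := add_pointP y => -[]; exists x.
  by move=> /= -> [].
split; first exact: add_point_embedding.
move=> V [y Vy] /open_add_pointE[_ FV].
have [y0|[x yx]] := add_pointP y; last first.
  by exists y; split=> //; rewrite yx; exists x.
have /filter_ex[x Vx] : F (incl @^-1` V) by apply: FV; rewrite -y0.
by exists (incl x); split=> //; exists x.
Qed.

End AddPoint.

(** * Components, and transfer of [P] along closed embeddings *)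

Lemma component_refl (X : topologicalType) (x : X) : component x x.
Proof. exact: connected_component_refl. Qed.

Lemma component_eq (X : topologicalType) (x y : X) :
  component x y -> component x = component y.
Proof. exact: same_connected_component. Qed.

Lemma component_is_closed (X : topologicalType) (x : X) : closed (component x).
Proof. exact/component_closed/closedT. Qed.

Lemma component_is_open (X : topologicalType) (x : X) :
  locally_connected_space X -> open (component x).
Proof.
move=> lc; rewrite openE => y xy; have [V [yV _ cV]] := lc y _ filterT.
apply: (filterS _ yV) => z Vz; apply: connected_component_trans xy _.
by exists V => //; split=> //; exact: nbhs_singleton.
Qed.

Lemma embedding_continuous (Z W : topologicalType) (e : Z -> W) :
  is_embedding e -> continuous e.
Proof.
by move=> [_ eopen]; apply/continuousP => V oV; apply/eopen; exists V.
Qed.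

(** An embedding is a homeomorphism onto its range; [f] below is the inverse of the corestriction
    [g]. *)
Lemma closed_hereditary_embedding (P : topologicalType -> Prop)
    (Z W : topologicalType) (e : Z -> W) :
  topological_property P -> closed_hereditary P ->
  is_embedding e -> closed (range e) -> P W -> P Z.
Proof.
move=> Ptop Pch e_emb ecl PW; have [einj eopen] := e_emb.
have eP z : e z \in range e by rewrite inE; exists z.
pose g (z : Z) : range e := SigSub (eP z).
have gsurj (w : range e) : exists z, e z = val w.
  by case: w => w /= /set_mem[z _ zw]; exists z.
have [f fE] := choice gsurj.
apply: Ptop (Pch _ _ ecl PW); exists f, g; split.
- by move=> w; apply: val_inj => /=; rewrite fE.
- by move=> z; apply: einj; rewrite fE.
- apply/continuousP => U /eopen[V oV <-]; exists V => //.
  by apply/seteqP; split => w /=; rewrite fE.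
- by apply: continuous_comp_initial; exact: embedding_continuous.
Qed.

(** The restriction of [e] to the preimage of [C] is an embedding into [C], and its range is the
    trace on [C] of the closed set [range e]. *)
Lemma closed_hereditary_preimage (P : topologicalType -> Prop)
    (Z W : topologicalType) (e : Z -> W) (C : set W) :
  topological_property P -> closed_hereditary P ->
  is_embedding e -> closed (range e) -> P (set_type C) ->
  P (set_type (e @^-1` C)).
Proof.
move=> Ptop Pch [einj eopen] ecl PC.
have eP (z : e @^-1` C) : e (val z) \in C.
  by apply: mem_set; exact: set_mem (valP z).
pose g (z : e @^-1` C) : C := SigSub (eP z).
apply: (@closed_hereditary_embedding P _ _ g) => //; first split.
- by move=> z t /(congr1 val)/= /einj /val_inj.
- move=> U; split=> [[V /eopen[V' oV' <-] <-]|[_ [V oV <-] <-]].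
    by exists (set_val @^-1` V') => //; exists V'.
  by exists (e @^-1` V) => //; apply/eopen; exists V.
- suff -> : range g = set_val @^-1` range e.
    by apply: closed_comp ecl => ? _; exact: initial_continuous.
  apply/seteqP; split=> [_ [z _ <-]|w /= [z _ zw]]; first by exists (val z).
  have zC : z \in e @^-1` C by rewrite inE /= zw; exact: set_mem (valP w).
  by exists (SigSub zC) => //; apply: val_inj.
Qed.

(** * Separation by real functions, and the vanishing functions *)

Local Open Scope ring_scope.

Lemma uniform_separatorC (R : realType) (T : topologicalType) (A B : set T) :
  uniform_separator A B -> uniform_separator B A.
Proof.
move=> /(@uniform_separatorP _ R)[f [fc f01 fA fB]].
apply/(@uniform_separatorP _ R); exists (fun x => 1 - f x); split.
- by move=> x; apply: cvgB; [exact: cvg_cst|exact: fc].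
- move=> _ [x _ <-]; have : `[0, 1]%classic (f x) by apply: f01; exists x.
  by rewrite /= !in_itv/= subr_ge0 lerBlDr lerDl andbC.
- by move=> _ [x Bx <-]; rewrite (imsub1 fB)//= subrr.
- by move=> _ [x Ax <-]; rewrite (imsub1 fA)//= subr0.
Qed.

Lemma uniform_separator_nonneg (R : realType) (T : topologicalType)
    (A B : set T) (g : T -> R) :
  continuous g -> (forall x, 0 <= g x) -> (forall x, A x -> g x = 0) ->
  (forall x, B x -> 1 <= g x) -> uniform_separator A B.
Proof.
move=> gc g0 gA gB; apply/(@uniform_separatorP _ R).
exists (fun x => Num.min (g x) 1); split.
- by move=> x; apply: continuous_min; [exact: gc|exact: cvg_cst].
- by move=> _ [x _ <-] /=; rewrite in_itv/= le_min ler01 g0 ge_min lexx orbT.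
- by move=> _ [x /gA -> <-] /=; exact/min_idPl.
- by move=> _ [x /gB gx1 <-] /=; exact/min_idPr.
Qed.

Section VanishingFunctions.
Context {R : realType} {X : topologicalType} (G : X -> set_system X).

(* [G x] stands for G_C, where C is the component of x. *)
Definition vanishing : set (X -> R) :=
  [set f : X -> R | [/\ continuous f, forall x, 0 <= f x,
    forall x, f @ G x --> (0 : R) &
    finite_set (@component X @` [set x | f x != 0])]].

Definition vanishing_filter : set_system X :=
  filter_from vanishing (fun f => [set x | f x < 1]).

Hypothesis G_proper : forall x, ProperFilter (G x).

Let G_filter x : Filter (G x).
Proof. exact: G_proper. Qed.

#[local] Existing Instance G_filter.

Lemma vanishing0 : vanishing (cst 0).
Proof.
split=> // [x|x|]; [exact: cvg_cst|exact: cvg_cst|].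
rewrite (_ : [set _ | _] = set0) ?image_set0//.
by apply/seteqP; split=> x //=; rewrite eqxx.
Qed.

Lemma vanishingD (f g : X -> R) : vanishing f -> vanishing g ->
  vanishing (f \+ g).
Proof.
move=> [fc f0 fG fs] [gc g0 gG gs]; split.
- by move=> x; apply: cvgD; [exact: fc|exact: gc].
- by move=> x; exact: addr_ge0.
- by move=> x; rewrite -[0]addr0; apply: cvgD.
- have := conj fs gs; rewrite -finite_setU; apply: sub_finite_set.
  move=> _ [x /= fg <-]; have [fx|fx] := eqVneq (f x) 0; last by left; exists x.
  by right; exists x => //; move: fg; rewrite fx add0r.
Qed.

Lemma vanishingZ (a : R) (f : X -> R) : 0 <= a -> vanishing f ->
  vanishing (fun x => a * f x).
Proof.
move=> a0 [fc f0 fG fs]; split.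
- by move=> x; apply: cvgM; [exact: cvg_cst|exact: fc].
- by move=> x; exact: mulr_ge0.
- by move=> x; rewrite -(mulr0 a); apply: cvgM => //; exact: cvg_cst.
- apply: (sub_finite_set _ fs) => _ [x /= fx <-]; exists x => //=.
  by apply: contra_neq fx => ->; rewrite mulr0.
Qed.

Lemma vanishing_filter_filter : Filter vanishing_filter.
Proof.
apply: filter_from_filter; first by exists (cst 0); exact: vanishing0.
move=> f g vf vg; exists (f \+ g); first exact: vanishingD.
have [_ f0 _ _] := vf; have [_ g0 _ _] := vg.
by move=> x /= fg; split; apply: le_lt_trans fg; rewrite ?lerDl ?lerDr.
Qed.

(** This makes the vanishing filter proper and puts the new point in the closure of every
    component. *)
Lemma vanishing_filter_meets x (A : set X) : vanishing_filter A -> G x A.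
Proof.
move=> [f [_ f0 fG _] fA]; apply: filterS fA _.
by apply: (cvgr_lt _ (fG x)).
Qed.

Lemma vanishing_cvg (f : X -> R) : vanishing f ->
  f @ vanishing_filter --> (0 : R).
Proof.
move=> vf; have FF := vanishing_filter_filter; have [_ f0 _ _] := vf.
(* Rescaling turns [f x < e] into the fixed threshold 1 of the filter base. *)
apply/cvgrPdist_lt => e e0; exists (fun x => e^-1 * f x).
  by apply: vanishingZ => //; rewrite invr_ge0 ltW.
by move=> x /=; rewrite sub0r normrN ger0_norm// mulrC ltr_pdivrMr// mul1r.
Qed.

Hypothesis X_lc : locally_connected_space X.
Hypothesis X_cr : completely_regular_space X.
Hypothesis G_component : forall x, G x (component x).
Hypothesis G_compatible : forall x y, component x y -> G x = G y.
Hypothesis G_free : forall x, ~ cluster (G x) x.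

(** As [G x] does not cluster at [x], some neighborhood [N] of [x] misses a member [A] of [G x]. A
    bump supported inside [N] and the component of [x] is then zero on a member of every [G y]. *)
Lemma vanishing_bump (x : X) (W : set X) : nbhs x W ->
  exists f, [/\ vanishing f, f x = 1 & forall y, ~ W y -> f y = 0].
Proof.
move=> xW.
have [A [N [GA xN AN]]] : exists A N, [/\ G x A, nbhs x N & A `&` N = set0].
  apply: contrapT => h; apply: (G_free (x := x)) => A N GA xN.
  by apply/set0P/eqP => AN; apply: h; exists A, N.
pose V := (W `&` N `&` component x)°.
have Vx : V x.
  apply: filterI; first exact: filterI.
  apply: open_nbhs_nbhs; split; first exact: component_is_open.
  exact: component_refl.
have VS : V `<=` W `&` N `&` component x := @interior_subset _ _.
have [] := X_cr (a := x) (B := ~` V); [exact/open_closedC/open_interior|by []|].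
move=> uT sep; have /(@uniform_separatorP _ R)[f [fc f01 fx fV]] :
  uniform_separator [set x] (~` V) by exists uT.
have fle y : f y <= 1.
  have : `[0, 1]%classic (f y) by apply: f01; exists y.
  by rewrite /= in_itv => /andP[].
have f1 y : ~ V y -> 1 - f y = 0.
  by move=> Vy; rewrite (fV (f y)) ?subrr//; exists y.
exists (fun y => 1 - f y); split; last 2 first.
- by rewrite (fx (f x)) ?subr0//; exists x.
- by move=> y Wy; apply: f1 => /VS[[]].
split.
- by move=> y; apply: cvgB; [exact: cvg_cst|exact: fc].
- by move=> y; rewrite subr_ge0.
- move=> y.
  (* The member of [G y] that avoids [V] is [A] when [y] lies in the component of [x], and the
     component of [y] otherwise. *)
  suff GV : G y (~` V).
    have : (fun z => cst 0 z : R) @ G y --> (0 : R) by exact: cvg_cst.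
    by apply: cvg_trans; apply: near_eq_cvg; apply: filterS GV => z /f1 ->.
  have [xy|xy] := pselect (component x y).
    rewrite -(G_compatible xy); apply: filterS GA => z Az /VS[[_ Nz] _].
    by have : (A `&` N) z by []; rewrite AN.
  apply: filterS (G_component y) => z yz /VS[_ xz]; apply: xy.
  by rewrite (component_eq xz) -(component_eq yz); exact: component_refl.
- apply: (@sub_finite_set _ _ [set component x]); last exact: finite_set1.
  move=> _ [y /= fy <-]; apply/esym/component_eq.
  by apply: contrapT => xy; move/eqP: fy; apply; apply: f1 => /VS[].
Qed.

End VanishingFunctions.

(** * Topology of the extension, and transfer of [P] to it *)

Section Connectification.
Context {R : realType} {X : topologicalType} (G : X -> set_system X).
Hypothesis G_proper : forall x, ProperFilter (G x).
Hypothesis X_lc : locally_connected_space X.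
Hypothesis X_tychonoff : tychonoff_space X.
Hypothesis G_component : forall x, G x (component x).
Hypothesis G_compatible : forall x y, component x y -> G x = G y.
Hypothesis G_free : forall x, ~ cluster (G x) x.

Let FF : Filter (vanishing_filter (R := R) G) :=
  vanishing_filter_filter G_proper.

Local Notation Y := (add_point FF).
Local Notation incl := (@add_point_incl X _ FF).

Definition extend_by_zero (f : X -> R) (y : Y) : R :=
  if y is Some x then f x else 0.

Lemma extend_by_zero_continuous (f : X -> R) : vanishing G f ->
  continuous (extend_by_zero f).
Proof.
move=> vf; apply: add_point_continuous; first by have [] := vf.
exact: (vanishing_cvg (G := G)).
Qed.

Lemma extension_separates (y z : Y) : y != z ->
  exists2 g : Y -> R, continuous g & g y != g z.
Proof.
(* Of two distinct points at least one lies in [X]; the bump is taken there. *)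
wlog : y z / exists x, y = incl x.
  move=> h yz; have [y0|] := add_pointP y; last by move=> ?; exact: h.
  have [z0|zx] := add_pointP z; first by move: yz; rewrite y0 z0 eqxx.
  have [g gc gzy] := h z y zx (contra_neq esym yz).
  by exists g => //; rewrite eq_sym.
move=> [x ->{y}] xz.
(* If [z] is the new point, any [W] will do, since the extended bump is 0 there anyway. *)
have [W xW zW] : exists2 W : set X, nbhs x W & forall t, z = incl t -> ~ W t.
  have [->|[t zt]] := add_pointP z; first by exists setT => //; exact: filterT.
  have xt : x != t by apply: contra_neq xz => ->; rewrite zt.
  have [_] := X_tychonoff; rewrite open_hausdorff => /(_ _ _ xt)[[A B] /=].
  move=> [xA tB] [oA oB /eqP AB]; exists A.
    by apply: open_nbhs_nbhs; rewrite inE in xA.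
  move=> t'; rewrite zt => -[<-] At; rewrite inE in tB.
  by have : (A `&` B) t by []; rewrite AB.
have [X_cr _] := X_tychonoff.
have [f [vf fx fW]] := vanishing_bump (R := R) G_proper X_lc X_cr
  G_component G_compatible G_free xW.
exists (extend_by_zero f); first exact: extend_by_zero_continuous.
rewrite /= fx; have [->|[t zt]] := add_pointP z; first exact: oner_neq0.
by rewrite zt /= fW ?oner_neq0//; exact: zW.
Qed.

Lemma extension_hausdorff : hausdorff_space Y.
Proof.
rewrite open_hausdorff => y z yz.
have [g /continuousP gc gyz] := extension_separates yz.
have := @norm_hausdorff R R; rewrite open_hausdorff => /(_ _ _ gyz).
move=> [[A B] /= [Ay Bz] [oA oB /eqP AB]]; rewrite !inE in Ay Bz.
exists (g @^-1` A, g @^-1` B); first by rewrite !inE.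
split; [exact: gc|exact: gc|].
by rewrite -preimage_setI AB preimage_set0.
Qed.

(** At the new point, a basic set [[f < 1]] inside the complement of [B] gives [f >= 1] on [B],
    while the extension of [f] is 0 at that point. At a point of [X], a bump does it with the two
    values exchanged. *)
Lemma extension_completely_regular : completely_regular_space Y.
Proof.
move=> y B clB By.
have /open_add_pointE[oB FB] := closed_openC clB.
have [y0|[x yx]] := add_pointP y.
  have [f vf fB] : vanishing_filter (R := R) G (incl @^-1` (~` B)).
    by apply: FB; rewrite -y0.
  have fc := extend_by_zero_continuous vf; apply: (uniform_separator_nonneg fc).
  - by case=> //= x; have [] := vf.
  - by move=> _ ->; rewrite y0.
  - case=> [x /= Bx|B0]; last by case: By; rewrite y0.
    by rewrite leNgt; apply/negP => /fB.
have [X_cr _] := X_tychonoff.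
have xB : nbhs x (incl @^-1` (~` B)).
  by apply: open_nbhs_nbhs; split=> //; rewrite /= -yx.
have [f [vf fx fB]] := vanishing_bump (R := R) G_proper X_lc X_cr
  G_component G_compatible G_free xB.
have fc := extend_by_zero_continuous vf.
apply: (uniform_separatorC R); apply: (uniform_separator_nonneg fc).
- by case=> //= t; have [] := vf.
- by case=> //= t Bt; rewrite fB//; exact.
- by move=> _ ->; rewrite yx /= fx.
Qed.

Lemma extension_connected : X -> connected [set: Y].
Proof.
move=> x0.
have clC x : closure (incl @` component x) None.
  move=> N; rewrite nbhsE => -[V [/open_add_pointE[_ FV] V0] VN].
  have Gx : G x (incl @^-1` V) by apply: vanishing_filter_meets (FV V0).
  have GP := G_proper x.
  have /filter_ex[z [Vz xz]] : G x (incl @^-1` V `&` component x).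
    exact: filterI.
  by exists (incl z); split; [exists z|exact: VN].
(* The closures are connected and all contain the new point. *)
suff -> : [set: Y] = \bigcup_x closure (incl @` component x).
  apply: bigcup_connected; first by exists None => x _.
  move=> x _; apply: connected_closure.
  apply: connected_continuous_connected; first exact: component_connected.
  by apply: continuous_subspaceT; exact: add_point_incl_continuous.
apply/seteqP; split=> // y _; have [->|[x ->]] := add_pointP y.
  by exists x0.
by exists x => //; apply: subset_closure; exists x => //; exact: component_refl.
Qed.

Lemma extension_property (P : topologicalType -> Prop) :
  X -> topological_property P -> closed_hereditary P -> finitely_additive P ->
  co_local P -> (forall x : X, P (set_type (component x))) -> P Y.
Proof.
move=> x0 Ptop Pch Pfa Pcl PC.
pose p : Y := None.
apply: (Pcl _ p [set U : set Y | open U /\ U p]).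
  by split=> [U //|N]; rewrite nbhsE => -[U ? ?]; exists U.
move=> U [oU U0].
have /open_add_pointE[oU' /(_ U0)[f [_ _ _ fs] fU]] := oU.
(* The complement of [U] omits the new point, so it embeds into [X] by a map [q] with closed
   range. *)
have qP (a : ~` U) : exists x, val a = incl x.
  have /= := set_mem (valP a).
  by have [->//|[x ->] _] := add_pointP (val a); exists x.
have [q qE] := choice qP.
have q_emb : is_embedding q.
  split=> [a b ab|V]; first by apply: val_inj; rewrite !qE ab.
  split=> [[W /open_add_pointE[oW _] <-]|[W oW <-]].
    by exists (incl @^-1` W) => //; apply/seteqP; split=> a /=; rewrite -qE.
  have [_ /(_ W)[/(_ oW)[W' oW' <-] _]] := add_point_embedding FF.
  by exists W' => //; apply/seteqP; split=> a /=; rewrite -qE.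
have q_range : range q = ~` (incl @^-1` U).
  apply/seteqP; split=> [_ [a _ <-]|x Ux].
    by rewrite /= -qE; exact: set_mem (valP a).
  have Uix : incl x \in ~` U by rewrite inE.
  exists (SigSub Uix) => //.
  by have /= [] := qE (SigSub Uix).
have q_closed : closed (range q) by rewrite q_range; exact: open_closedC.
(* Adding [component x0] keeps the list non-empty even if [f] is zero everywhere, as finite
   additivity is stated for at least one piece. Absence of duplicates makes the pieces disjoint. *)
have [s us sE] : exists2 s : seq (set X), uniq s &
    [set` s] = component x0 |` (@component X @` [set x | f x != 0]).
  have := conj (finite_set1 (component x0)) fs.
  rewrite -finite_setU => /finite_seqP[s ->].
  exists (undup s); first exact: undup_uniq.
  by apply/seteqP; split=> C /=; rewrite mem_undup.
have sC C : C \in s -> exists x, C = component x.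
  move=> Cs; have : [set` s] C by [].
  by rewrite sE => -[->|[x _ <-]]; [exists x0|exists x].
have s0 : component x0 \in s.
  by have : [set` s] (component x0) by rewrite sE; left.
case: s us sC s0 sE => [|C0 s'] // us sC _ sE; set s := C0 :: s' in us sC sE.
have memC (i : 'I_(size s').+1) : nth set0 s i \in s by exact: mem_nth.
apply: (Pfa _ _ (fun i : 'I_(size s').+1 => q @^-1` (nth set0 s i))).
- move=> i; have [x ->] := sC _ (memC i).
  apply: closed_comp; last exact: component_is_closed.
  by move=> a _; exact: embedding_continuous.
- move=> i j _ _ [a /= [ai aj]]; apply/val_inj/eqP.
  have lt_s (k : 'I_(size s').+1) : (k < size s)%N := ltn_ord k.
  rewrite -(nth_uniq set0 (lt_s i) (lt_s j) us); apply/eqP.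
  have [x ix] := sC _ (memC i); have [y jy] := sC _ (memC j).
  rewrite ix jy in ai aj *.
  by rewrite (component_eq ai) (component_eq aj).
- apply/seteqP; split=> // a _.
  have qs : component (q a) \in s.
    have : [set` s] (component (q a)); last by [].
    (* If [f] were 0 at [q a], this point would lie in [[f < 1]], hence in [U]. *)
    rewrite sE; right; exists (q a) => //=; apply/eqP => fq.
    have : (~` (incl @^-1` U)) (q a) by rewrite -q_range; exists a.
    by apply; apply: fU; rewrite /= fq ltr01.
  have qi : (index (component (q a)) s < size s)%N by rewrite index_mem.
  exists (Ordinal (n := (size s').+1) qi) => //=; rewrite nth_index//.
  exact: component_refl.
- move=> i; have [x ->] := sC _ (memC i).
  exact: closed_hereditary_preimage.
Qed.

End Connectification.

Local Close Scope ring_scope.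

Theorem theorem2p9 (X : topologicalType) (P : topologicalType -> Prop)
    (X_nonempty : [set: X] !=set0)
    (X_locally_connected : locally_connected_space X)
    (X_tychonoff : tychonoff_space X)
    (no_compact_component : forall x : X, ~ compact (component x))
    (P_topological : topological_property P)
    (P_closed_hereditary : closed_hereditary P)
    (P_finitely_additive : finitely_additive P)
    (P_co_local : co_local P) :
  (forall x : X, P (set_type (component x))) \/ P X ->
  exists (Y : topologicalType) (e : X -> Y),
    [/\ is_one_point_connectification e, tychonoff_space Y & P Y].
Proof.
move=> PX; have {PX}PC (x : X) : P (set_type (component x)).
  case: PX => // PX.
  apply: P_closed_hereditary => //; exact: component_is_closed.
have [x0 _] := X_nonempty.
(* Filters are chosen for sets rather than points, so that points of one component share the same
   filter. For compact [C] the value [setT] is a dummy. *)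
have /choice[H HP] (C : set X) : exists F : set_system X, ~ compact C ->
    [/\ ProperFilter F, F C & C `&` cluster F = set0].
  have [cC|ncC] := pselect (compact C); first by exists setT.
  apply: contrapT => h; apply: ncC => F FF FC.
  apply/set0P/eqP => CF; apply: h; exists F => _; by split.
pose G x := H (component x).
have G_proper : forall x, ProperFilter (G x).
  by move=> x; have [] := HP _ (@no_compact_component x).
have G_component x : G x (component x).
  by have [] := HP _ (@no_compact_component x).
have G_compatible x y : component x y -> G x = G y.
  by move=> xy; rewrite /G (component_eq xy).
have G_free x : ~ cluster (G x) x.
  have [_ _ CG] := HP _ (@no_compact_component x) => Gx.
  have : (component x `&` cluster (G x)) x by split=> //; exact: component_refl.
  by rewrite CG.
pose FF := vanishing_filter_filter (R := Rdefinitions.R) G_proper.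
exists (add_point FF), (@add_point_incl X _ FF); split.
- split; last exact: extension_connected.
  (* Members of the vanishing filter belong to the proper filter [G x0], hence are inhabited. *)
  apply: add_point_one_point_extension; apply: Build_ProperFilter_ex.
  by move=> A /(vanishing_filter_meets G_proper x0)/filter_ex.
- split; first exact: extension_completely_regular.
  exact: extension_hausdorff.
- exact: extension_property.
Qed.
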